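(* There is a deterministic $O(\log k)$-competitive algorithm for the online Steiner network problem with edge duplication, where $k$ is the number of terminals that arrive online.
   Context: Setting: there is an underlying complete graph $G=(V,E)$ with edge lengths $d(u,v)$ such that $(V,d)$ is a finite metric space whose minimum edge length (smallest distance between distinct points) is $1$. The algorithm does not know $G$ initially; at each time step it only knows the submetric of $d$ induced on the terminals that have arrived so far. For a multigraph $H$ on $V$, its cost $c(H)$ is the sum of the lengths of its edges, counted with multiplicity. Online Steiner network problem (with edge duplication): terminal pairs $(s_i,t_i)\in V\times V$ arrive one by one, each with a requirement $R_i$ (a positive integer). After each arrival the algorithm must maintain a multigraph $H$ which, for every pair $(s_i,t_i)$ that has arrived, contains $R_i$ edge-disjoint paths between $s_i$ and $t_i$. Multiple copies of an edge may be bought. Once an edge (copy) has been added to $H$ it cannot be removed. The cost is $c(H)$ for the final $H$. The terminals are the endpoints of the arriving pairs. Competitiveness: let $\mathrm{OPT}$ be the minimum cost of an offline solution, i.e. of a multigraph on $V$ satisfying all requirements that arrived. A deterministic online algorithm is $O(\log k)$-competitive if there is an absolute constant $c$ such that on every instance with $k\ge 2$ terminals the cost of the algorithm is at most $c\cdot\log k\cdot \mathrm{OPT}$. The algorithm is not told $k$ or the requirements in advance. *)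

(* Defs.v *)
From HB Require Import structures.
From mathcomp Require Import all_boot all_order all_algebra.
From mathcomp Require Import all_classical all_reals all_analysis.

Set Implicit Arguments.
Unset Strict Implicit.
Unset Printing Implicit Defensive.

Import Order.TTheory GRing.Theory Num.Theory.

Local Open Scope classical_set_scope.
Local Open Scope ring_scope.

Definition is_metric (R : realType) (V : finType) (d : V -> V -> R) : Prop :=
  [/\ forall u v, d u v = 0 <-> u = v,
      forall u v, d u v = d v u &
      forall u v w, d u w <= d u v + d v w].

Definition min_edge_length1 (R : realType) (V : finType) (d : V -> V -> R)
    : Prop :=
  (exists u v, u != v /\ d u v = 1) /\ (forall u v, u != v -> 1 <= d u v).

(* A multigraph on [V] is the list of its edge copies: a position in the list
   is a copy, and the orientation of a listed pair is irrelevant.  Loops are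
   not excluded, but they have length 0 and lie on no path. *)
Definition multigraph (V : finType) : Type := seq (V * V).

Definition edge_copy (V : finType) (H : multigraph V) : finType :=
  'I_(size H).

Definition joins (V : finType) (H : multigraph V) (e : edge_copy H)
    (u v : V) : bool :=
  (tnth (in_tuple H) e == (u, v)) || (tnth (in_tuple H) e == (v, u)).

Definition cost (R : realType) (V : finType) (d : V -> V -> R)
    (H : multigraph V) : R :=
  \sum_(e <- H) d e.1 e.2.

(* A walk from [x] is a list of steps [(e, v)]: traverse the copy [e] to [v]. *)
Fixpoint is_walk (V : finType) (H : multigraph V) (x : V)
    (p : seq (edge_copy H * V)) : bool :=
  if p is (e, v) :: p' then joins e x v && is_walk v p' else true.

Definition is_path (V : finType) (H : multigraph V) (s t : V)
    (p : seq (edge_copy H * V)) : bool :=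
  [&& is_walk s p, last s (unzip2 p) == t & uniq (s :: unzip2 p)].

(* For [s = t] the empty path may be repeated, so there is no constraint. *)
Definition edge_disjoint_paths (V : finType) (H : multigraph V) (r : nat)
    (s t : V) : Prop :=
  exists P : 'I_r -> seq (edge_copy H * V),
    (forall i, is_path s t (P i)) /\
    (forall i j, i != j ->
       forall e, ~~ ((e \in unzip1 (P i)) && (e \in unzip1 (P j)))).

(* [(s, t, r)]: the pair [(s, t)] arrives with requirement [r]. *)
Definition request (V : finType) : Type := (V * V * nat)%type.
Definition source (V : finType) (q : request V) : V := q.1.1.
Definition target (V : finType) (q : request V) : V := q.1.2.
Definition requirement (V : finType) (q : request V) : nat := q.2.

Definition terminals (V : finType) (qs : seq (request V)) : seq V :=
  undup (flatten [seq [:: source q; target q] | q <- qs]).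

Definition satisfies (V : finType) (H : multigraph V) (qs : seq (request V))
    : Prop :=
  forall s t r, (s, t, r) \in qs -> edge_disjoint_paths H r s t.

Record is_instance (R : realType) (V : finType) (d : V -> V -> R)
    (qs : seq (request V)) : Prop := IsInstance {
  instance_metric : is_metric d;
  instance_min_edge : min_edge_length1 d;
  instance_requirement : forall s t r, (s, t, r) \in qs -> (0 < r)%N
}.

(* The infimum is a minimum: see [OPT_min]. *)
Definition OPT (R : realType) (V : finType) (d : V -> V -> R)
    (qs : seq (request V)) : R :=
  inf [set cost d H | H in [set H : multigraph V | satisfies H qs]].

Lemma edge_disjoint_paths_copies (V : finType) (H1 H2 : multigraph V)
    (s t : V) (r : nat) :
  edge_disjoint_paths (H1 ++ nseq r (s, t) ++ H2) r s t.
Proof.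
have [<-|nst] := eqVneq s t.
  exists (fun=> [::]); split=> [i|i j _ e]; last by rewrite in_nil.
  by rewrite /is_path /= eqxx.
have ltP (i : 'I_r) :
    (size H1 + i < size (H1 ++ nseq r (s, t) ++ H2))%N.
  by rewrite !size_cat size_nseq ltn_add2l (leq_trans (ltn_ord i)) ?leq_addr.
exists (fun i => [:: (Ordinal (ltP i), t)]); split=> [i|i j nij e].
  rewrite /is_path /= eqxx inE nst /joins !andbT.
  rewrite (tnth_nth (s, t)) /= nth_cat ltnNge leq_addr /= addKn.
  by rewrite nth_cat size_nseq ltn_ord nth_nseq ltn_ord eqxx.
rewrite /= !inE; apply/negP => /andP[/eqP -> /eqP/(congr1 val)/= /addnI /val_inj].
by move/eqP; rewrite (negPf nij).
Qed.

Lemma satisfiable (V : finType) (qs : seq (request V)) :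
  exists H : multigraph V, satisfies H qs.
Proof.
exists (flatten [seq nseq (requirement q) (source q, target q) | q <- qs]).
move=> s t r /splitPr[q1 q2]; rewrite map_cat flatten_cat /=.
exact: edge_disjoint_paths_copies.
Qed.

Lemma has_min_finite_below (R : realType) (E : set R) (vs : seq R) (x0 : R) :
  E x0 -> (forall x, E x -> x <= x0 -> x \in vs) ->
  exists m, E m /\ forall y, E y -> m <= y.
Proof.
have [n] := ubnP (size vs); elim: n vs x0 => // n IHn vs x0 szv Ex0 vsP.
have [[y [Ey yx0]]|noy] := pselect (exists y, E y /\ y < x0); last first.
  exists x0; split=> // y Ey; rewrite leNgt; apply/negP => yx0.
  by apply: noy; exists y.
have x0vs := vsP _ Ex0 (lexx _).
apply: (IHn [seq x <- vs | x != x0] y) => // [|x Ex xy].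
  rewrite -ltnS (leq_trans _ szv)// ltnS size_filter.
  rewrite -(count_predC (predC1 x0) vs) -[ltnLHS]addn0 ltn_add2l -has_count.
  by apply/hasP; exists x0; rewrite //= negbK.
by rewrite mem_filter (lt_eqF (le_lt_trans xy yx0)) vsP// (le_trans xy (ltW yx0)).
Qed.

Lemma cost_size (R : realType) (V : finType) (d : V -> V -> R)
    (H : multigraph V) : is_metric d -> min_edge_length1 d ->
  exists2 H' : multigraph V, cost d H' = cost d H & (size H')%:R <= cost d H.
Proof.
case=> d0 _ _ [_ d1]; exists [seq e <- H | e.1 != e.2].
  rewrite /cost big_filter [RHS](bigID (fun e => e.1 != e.2)) /= addrC.
  rewrite [X in X + _]big1 ?add0r// => e; rewrite negbK => /eqP ->.
  exact/d0.
elim: H => [|[u v] H IH]; first by rewrite /cost big_nil.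
rewrite /cost big_cons /=; case: ifP => [uv|/negbFE/eqP ->] /=.
  by rewrite -natr1 addrC lerD// d1.
by rewrite (d0 v v).2 ?add0r.
Qed.

Lemma OPT_min (R : realType) (V : finType) (d : V -> V -> R)
    (qs : seq (request V)) : is_metric d -> min_edge_length1 d ->
  (exists2 H : multigraph V, satisfies H qs & cost d H = OPT d qs) /\
  (forall H : multigraph V, satisfies H qs -> OPT d qs <= cost d H).
Proof.
move=> dm d1; pose E := [set cost d H | H in [set H | satisfies H qs]].
have [H0 H0P] := satisfiable qs; have E0 : E (cost d H0) by exists H0.
pose N := Num.bound (cost d H0).
pose vs := flatten
  [seq [seq cost d (tval t) | t <- enum {: n.-tuple (V * V)}] | n <- iota 0 N].
have vsP x : E x -> x <= cost d H0 -> x \in vs.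
  move=> [H _ <-] le0; have [H' cH' szH'] := cost_size H dm d1.
  have ltN : (size H' < N)%N.
    have szH0 := le_trans szH' le0.
    by rewrite -(ltr_nat R) (le_lt_trans szH0)// archi_boundP// (le_trans _ szH0).
  apply/flattenP; eexists; first by apply/mapP; exists (size H'); rewrite ?mem_iota.
  by rewrite -cH'; apply/mapP; exists (in_tuple H'); rewrite ?mem_enum.
have [m [[H HP Hm] mle]] := has_min_finite_below E0 vsP.
have lbm : lbound E m by move=> y /mle.
have -> : OPT d qs = m.
  apply/eqP; rewrite eq_le lb_le_inf ?andbT//; last by exists m, H.
  by apply: ge_inf; [exists m|exists H].
by split=> [|H' H'P]; [exists H|apply: mle; exists H'].
Qed.

(* After [n] arrivals the terminals are named by the arrival at which they
   appear: [(i, false)] is the source of the [i]-th pair and [(i, true)] its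
   target.  Two names denote the same vertex exactly when their distance
   is 0. *)
Definition name (n : nat) : Type := ('I_n * bool)%type.

Record view (R : realType) (n : nat) : Type := View {
  view_requirement : 'I_n -> nat;
  view_dist : name n -> name n -> R
}.

(* [A n w] lists the edge copies added in response to the [n]-th arrival.  The
   views at earlier times are restrictions of [w], hence so are the algorithm's
   own past decisions functions of [w]. *)
Definition online_algorithm (R : realType) : Type :=
  forall n : nat, view R n -> seq (name n * name n).

Definition vertex_of (V : finType) (qs : seq (request V))
    (x : name (size qs)) : V :=
  let q := tnth (in_tuple qs) x.1 in if x.2 then target q else source q.

Definition view_of (R : realType) (V : finType) (d : V -> V -> R)
    (qs : seq (request V)) : view R (size qs) :=
  {| view_requirement := fun i => requirement (tnth (in_tuple qs) i);
     view_dist := fun x y => d (vertex_of x) (vertex_of y) |}.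

Definition bought_last (R : realType) (A : online_algorithm R) (V : finType)
    (d : V -> V -> R) (qs : seq (request V)) : multigraph V :=
  [seq (vertex_of e.1, vertex_of e.2) | e <- A (size qs) (view_of d qs)].

(* The multigraph maintained after the first [i] arrivals. *)
Definition run (R : realType) (A : online_algorithm R) (V : finType)
    (d : V -> V -> R) (qs : seq (request V)) (i : nat) : multigraph V :=
  flatten [seq bought_last A d (take j.+1 qs) | j <- iota 0 i].

Definition solves_steiner_network (R : realType) (A : online_algorithm R)
    : Prop :=
  forall (V : finType) (d : V -> V -> R) (qs : seq (request V)),
    is_instance d qs ->
    forall i, (i <= size qs)%N -> satisfies (run A d qs i) (take i qs).

Definition log_competitive (R : realType) (A : online_algorithm R) : Prop :=
  exists c : R,
    forall (V : finType) (d : V -> V -> R) (qs : seq (request V)),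
      is_instance d qs ->
      let k := size (terminals qs) in
      (2 <= k)%N ->
      cost d (run A d qs (size qs)) <= c * ln k%:R * OPT d qs.

(* Main.v *)
Require Import Defs.
From mathcomp Require Import all_boot all_order all_algebra.
From mathcomp Require Import perm.
From mathcomp Require Import all_classical all_reals all_analysis.
From mathcomp Require Import ring lra zify.

(** Requests are classified by [l = up_log 2 r]; each class runs its own
Steiner forest algorithm and buys [2 ^ l] copies of every edge of its forest.
In one class, level [j] carries a [4 ^ j]-separated net of centers, each an
endpoint of a pair at distance at least [4 ^ j].  A terminal climbs through
centers of increasing levels, every center paying for at most one edge to the
next level, and the two centers reached at the level of the pair's distance are
joined by an edge that merges two blocks of centers.  So the forest costs
[O(\sum_j 4 ^ j * #centers_j)].

Against this, the optimum [H] is bounded from below by random ball partitions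
(Fakcharoenphol-Rao-Talwar, Calinescu-Karloff-Rabani): cut [V] by balls of
radius [m] around the terminals taken in random order, [4 ^ j <= m < 2 * 4 ^ j].
Centers of level [j + 1] in one class lie in distinct parts, each of which
separates a pair of the class and hence is left by [r] edges of [H]; as the
weights [2 ^ l] are geometric, all classes together are paid by [O(1)] times
the number of cut edges.  An edge [uv] is cut only by a terminal that comes
first among those at least as close to it, while [m] falls in an interval of
length [d u v].  The ranges of [m] are disjoint for different [j],
so summing over all levels costs [O(d u v)] times the harmonic sum of the
number of terminals. *)

Set Implicit Arguments.
Unset Strict Implicit.
Unset Printing Implicit Defensive.

Import Order.TTheory GRing.Theory Num.Theory.

Local Open Scope ring_scope.

(** * The algorithm *)

(* One class of requests: [blocks j] groups the centers of level [j] already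
   joined at that level, [parents j] sends a center of level [j] to one of level
   [j.+1], and [bought] lists the edges of the forest in order of purchase. *)
Record state (T : Type) := State {
  blocks : nat -> seq (seq T);
  parents : nat -> seq (T * T);
  bought : seq (T * T)
}.

Definition update (X : Type) (f : nat -> X) (j : nat) (x : X) : nat -> X :=
  fun i => if i == j then x else f i.

Definition centers (T : Type) (st : state T) (j : nat) : seq T :=
  flatten (blocks st j).

Definition link (T : Type) (j : nat) (y c : T) (st : state T) : state T :=
  State (blocks st) (update (parents st) j ((y, c) :: parents st j))
        (rcons (bought st) (y, c)).

Section Algorithm.
Variables (R : realType) (T : Type) (d : T -> T -> R).

(* Vertices are compared through [d x y == 0] only, so that the algorithm can run
   on the names of a view, several of which may denote the same vertex. *)
Definition settle (j : nat) (x : T) (st : state T) : state T * T :=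
  if [seq c <- centers st j | d c x < 4 ^+ j] is c :: _ then (st, c)
  else (State (update (blocks st) j ([:: x] :: blocks st j)) (parents st)
              (bought st), x).

(** The parent of a center is settled near the terminal [x] that first climbs through it, not near
    the center; later climbs reuse it without buying anything. *)
Definition climb1 (j : nat) (x : T) (sy : state T * T) : state T * T :=
  if [seq e <- parents sy.1 j | d e.1 sy.2 == 0] is e :: _ then (sy.1, e.2)
  else let sc := settle j.+1 x sy.1 in (link j sy.2 sc.2 sc.1, sc.2).

Fixpoint climb (n : nat) (x : T) (st : state T) : state T * T :=
  if n is n'.+1 then climb1 n' x (climb n' x st) else settle 0 x st.

Definition holds (x : T) (b : seq T) : bool := has (fun c => d c x == 0) b.

(** The blocks of a level act as a union-find structure: an edge is bought only when it merges
    blocks. *)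
Definition fuse (j : nat) (y z : T) (st : state T) : state T :=
  if has (fun b => holds y b && holds z b) (blocks st j) then st else
  State (update (blocks st) j
          (flatten [seq b <- blocks st j | holds y b || holds z b]
           :: [seq b <- blocks st j | ~~ (holds y b || holds z b)]))
        (parents st) (rcons (bought st) (y, z)).

Definition level (s t : T) : nat := trunc_log 4 (Num.truncn (d s t)).

Definition serve (st : state T) (p : T * T) : state T :=
  if d p.1 p.2 == 0 then st else
  let L := level p.1 p.2 in
  let sy := climb L p.1 st in
  let sz := climb L p.2 sy.1 in
  fuse L sy.2 sz.2 sz.1.

Definition outcome (ps : seq (T * T)) : state T :=
  foldl serve (State (fun=> [::]) (fun=> [::]) [::]) ps.

(** Class [l] rounds requirements up to [2 ^ l], which at most doubles a positive requirement. *)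
Definition class_pairs (l : nat) (qs : seq (T * T * nat)) : seq (T * T) :=
  [seq q.1 | q <- qs & up_log 2 q.2 == l].

Definition forest (l : nat) (qs : seq (T * T * nat)) : seq (T * T) :=
  bought (outcome (class_pairs l qs)).

(** No state is stored between arrivals: the forest of the class is recomputed without and with the
    last request, and the new suffix is bought [2 ^ l] times. *)
Definition response (qs : seq (T * T * nat)) : seq (T * T) :=
  if rev qs is q :: qs' then
    let l := up_log 2 q.2 in
    flatten (nseq (2 ^ l) (drop (size (forest l (rev qs'))) (forest l qs)))
  else [::].

End Algorithm.

(** * The algorithm only sees distances *)

Section Naturality.
Variables (R : realType) (T U : Type) (dT : T -> T -> R) (dU : U -> U -> R).
Variable f : T -> U.
Hypothesis fd : forall x y, dU (f x) (f y) = dT x y.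

Definition map_pair (e : T * T) : U * U := (f e.1, f e.2).

Definition map_state (st : state T) : state U :=
  State (map (map f) \o blocks st) (map map_pair \o parents st)
        (map map_pair (bought st)).

Lemma update_map (X Y : Type) (g : X -> Y) (h : nat -> X) j x :
  update (g \o h) j (g x) = g \o update h j x.
Proof. by apply/funext => i; rewrite /update /=; case: ifP. Qed.

Lemma centers_map st j : centers (map_state st) j = map f (centers st j).
Proof. by rewrite /centers /= map_flatten. Qed.

Lemma settle_map j x st : settle dU j (f x) (map_state st) =
  (map_state (settle dT j x st).1, f (settle dT j x st).2).
Proof.
rewrite /settle centers_map filter_map.
rewrite (@eq_filter _ (preim f _) (fun c => dT c x < 4 ^+ j)); last first.
  by move=> c /=; rewrite fd.
case: [seq _ <- _ | _] => //=; rewrite /map_state.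
by rewrite -(update_map (map (map f))).
Qed.

Lemma link_map j y c st :
  link j (f y) (f c) (map_state st) = map_state (link j y c st).
Proof.
rewrite /link /map_state /= map_rcons; congr State.
by rewrite -(update_map (map map_pair)).
Qed.

Lemma climb_map n x st : climb dU n (f x) (map_state st) =
  (map_state (climb dT n x st).1, f (climb dT n x st).2).
Proof.
elim: n => [|n IH] /=; first exact: settle_map.
rewrite IH /climb1 /= filter_map.
rewrite (@eq_filter _ (preim map_pair _)
  (fun e => dT e.1 (climb dT n x st).2 == 0)); last by move=> e /=; rewrite fd.
by case: [seq _ <- _ | _] => //=; rewrite settle_map /= link_map.
Qed.

Lemma holds_map x b : holds dU (f x) (map f b) = holds dT x b.
Proof. by rewrite /holds has_map; apply: eq_has => c /=; rewrite fd. Qed.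

Lemma fuse_map j y z st :
  fuse dU j (f y) (f z) (map_state st) = map_state (fuse dT j y z st).
Proof.
rewrite /fuse /= has_map (@eq_has _ (preim _ _)
  (fun b => holds dT y b && holds dT z b)); last first.
  by move=> b /=; rewrite !holds_map.
case: ifP => //= _; rewrite /map_state /= map_rcons -(update_map (map (map f))).
rewrite /= !filter_map map_flatten; congr (State (update _ _ (flatten _ :: _)) _ _).
  by congr map; apply: eq_filter => b /=; rewrite !holds_map.
by congr map; apply: eq_filter => b /=; rewrite !holds_map.
Qed.

Lemma outcome_map ps :
  outcome dU (map map_pair ps) = map_state (outcome dT ps).
Proof.
suff foldl_map st : foldl (serve dU) (map_state st) (map map_pair ps) =
    map_state (foldl (serve dT) st ps) by rewrite /outcome -foldl_map.
elim: ps st => //= p ps IH st; rewrite -IH; congr foldl.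
rewrite /serve /level /= fd; case: ifP => // _.
by rewrite !climb_map /= fuse_map.
Qed.

(** Every test reads distances only, so a distance-preserving [f] commutes with the algorithm even
    if it is not injective, as when several names denote one vertex. *)
Lemma response_map qs :
  response dU [seq (map_pair q.1, q.2) | q <- qs] =
  map map_pair (response dT qs).
Proof.
have forest_map l ps : forest dU l [seq (map_pair q.1, q.2) | q <- ps] =
    map map_pair (forest dT l ps).
  rewrite /forest [map _ (bought _)]/(bought (map_state _)) -outcome_map.
  by rewrite /class_pairs filter_map -!map_comp.
rewrite /response -map_rev; case: (rev qs) => //= q qs'.
by rewrite -map_rev !forest_map size_map -map_drop map_flatten map_nseq.
Qed.

End Naturality.

(** * Cost of a forest in terms of its centers *)

Definition linked (V : finType) (F : seq (V * V)) : rel V :=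
  connect (fun x y => ((x, y) \in F) || ((y, x) \in F)).

Lemma linked_sym (V : finType) (F : seq (V * V)) : symmetric (linked F).
Proof. by apply: sym_connect_sym => x y; rewrite orbC. Qed.

Lemma linked_mono (V : finType) (F G : seq (V * V)) x y :
  {subset F <= G} -> linked F x y -> linked G x y.
Proof.
move=> FG; apply: connect_sub => {}x {}y xy; apply: connect1.
by case/orP: xy => /FG ->; rewrite ?orbT.
Qed.

Lemma linked_edge (V : finType) (F : seq (V * V)) x y :
  (x, y) \in F -> linked F x y.
Proof. by move=> xy; apply: connect1; rewrite xy. Qed.

Lemma update_eq (X : Type) (f : nat -> X) j x : update f j x j = x.
Proof. by rewrite /update eqxx. Qed.

Lemma update_neq (X : Type) (f : nat -> X) j x i : i != j -> update f j x i = f i.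
Proof. by rewrite /update => /negPf ->. Qed.

(** Amortization step: an operation changes the credit of a single level [j], whose gain must cover
    the price [a]. *)
Lemma ler_sum_change (R : numDomainType) (J j : nat) (f g : nat -> R) (a : R) :
  (j < J)%N -> (forall i, i != j -> g i = f i) -> f j + a <= g j ->
  \sum_(i < J) f i + a <= \sum_(i < J) g i.
Proof.
move=> jJ fg le_j; rewrite (bigD1 (Ordinal jJ)) //= [leRHS](bigD1 (Ordinal jJ)) //=.
by rewrite addrAC lerD // ler_sum // => i /fg ->.
Qed.

Section Invariant.
Variables (R : realType) (V : finType) (d : V -> V -> R) (J : nat).
Hypothesis d_metric : is_metric d.
Hypothesis d_min : forall u v, u != v -> 1 <= d u v.
Hypothesis d_max : forall u v, d u v < 4 ^+ J.

Lemma metric_eq0 u v : (d u v == 0) = (u == v).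
Proof.
by case: d_metric => d0 _ _; apply/eqP/eqP => /d0.
Qed.

Lemma metric_sym u v : d u v = d v u.
Proof. by case: d_metric. Qed.

Lemma metric_tri v u w : d u w <= d u v + d v w.
Proof. by case: d_metric. Qed.

Lemma metric_ge0 u v : 0 <= d u v.
Proof. by have [->|/d_min] := eqVneq u v; [case: d_metric => /(_ v v) [_ ->]|lra]. Qed.

Definition active (ps : seq (V * V)) (j : nat) (x : V) : Prop :=
  exists2 p, p \in ps & ((x == p.1) || (x == p.2)) && (4 ^+ j <= d p.1 p.2).

Lemma activeS ps j x : active ps j.+1 x -> active ps j x.
Proof.
case=> p pps /andP[xp le]; exists p; rewrite // xp (le_trans _ le) //.
by rewrite ler_eXn2l ?ltr1n.
Qed.

Lemma active_sub ps ps' j x :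
  {subset ps <= ps'} -> active ps j x -> active ps' j x.
Proof. by move=> sub [p /sub pps' xp]; exists p. Qed.

(* A center pays for its edge to its parent, and for one of the merges that
   reduce the number of blocks below the number of centers. *)
Definition credit (st : state V) (j : nat) : R :=
  4 ^+ j * (6 * (size (parents st j))%:R
            + 8 * ((size (centers st j))%:R - (size (blocks st j))%:R)).

(** Separation and activity of the centers feed the lower bound on the optimum; [inv_cost] is the
    amortized upper bound on the forest. *)
Record invariant (ps : seq (V * V)) (st : state V) : Prop := Invariant {
  inv_separated : forall j, {in centers st j &, forall x y,
    x != y -> 4 ^+ j <= d x y};
  inv_uniq : forall j, uniq (centers st j);
  inv_active : forall j, {in centers st j, forall x, active ps j x};
  inv_parents : forall j, {in parents st j, forall e,
    [/\ e.1 \in centers st j, e.2 \in centers st j.+1,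
        d e.1 e.2 <= 6 * 4 ^+ j & linked (bought st) e.1 e.2]};
  inv_uniq_parents : forall j, uniq (unzip1 (parents st j));
  inv_blocks : forall j, {in blocks st j, forall b,
    {in b &, forall x y, linked (bought st) x y}};
  inv_cost : cost d (bought st) <= \sum_(j < J) credit st j
}.

Definition extends (st st' : state V) : Prop :=
  (forall j, {subset centers st j <= centers st' j}) /\
  exists F, bought st' = bought st ++ F.

Lemma extends_refl st : extends st st.
Proof. by split=> [j x //|]; exists [::]; rewrite cats0. Qed.

Lemma extends_trans st2 st1 st3 :
  extends st1 st2 -> extends st2 st3 -> extends st1 st3.
Proof.
move=> [c12 [F12 e12]] [c23 [F23 e23]]; split=> [j x /c12 /c23 //|].
by exists (F12 ++ F23); rewrite e23 e12 catA.
Qed.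

Lemma extends_linked st st' x y :
  extends st st' -> linked (bought st) x y -> linked (bought st') x y.
Proof.
by move=> [_ [F ->]]; apply: linked_mono => e eF; rewrite mem_cat eF.
Qed.

Lemma cost_rcons F x y : cost d (rcons F (x, y)) = cost d F + d x y.
Proof. by rewrite /cost -cats1 big_cat big_seq1. Qed.

(** Ensures that every operation happens at a level counted in the sum of [inv_cost]. *)
Lemma active_lt ps j x : active ps j x -> (j < J)%N.
Proof.
case=> p _ /andP[_ /le_lt_trans /(_ (d_max _ _))].
by rewrite ltr_eXn2l ?ltr1n.
Qed.

Lemma settleP ps j x st (r := settle d j x st) :
  invariant ps st -> active ps j x ->
  [/\ invariant ps r.1, r.2 \in centers r.1 j, d r.2 x < 4 ^+ j,
      extends st r.1 & parents r.1 = parents st].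
Proof.
move=> inv xact; rewrite {}/r /settle.
case E: [seq _ <- _ | _] => [|c s] /=; last first.
  have : c \in [seq c <- centers st j | d c x < 4 ^+ j] by rewrite E mem_head.
  by rewrite mem_filter => /andP[dcx cj]; split=> //; apply: extends_refl.
have far c : c \in centers st j -> 4 ^+ j <= d c x.
  move=> cj; rewrite leNgt; apply/negP => dcx.
  have : c \in [seq c <- centers st j | d c x < 4 ^+ j] by rewrite mem_filter dcx.
  by rewrite E.
have dxx : d x x = 0 by apply/eqP; rewrite metric_eq0.
have pow_gt0 : 0 < 4 ^+ j :> R by rewrite exprn_gt0.
set st' := State _ _ _.
have cE i : centers st' i = if i == j then x :: centers st j else centers st i.
  by rewrite /centers /= /update; case: eqP.
have sub i : {subset centers st i <= centers st' i}.
  by move=> c; rewrite cE; case: eqP => // ->; rewrite inE => ->; rewrite orbT.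
split=> //; last 1 first.
- by split=> [i|]; [exact: sub | exists [::]; rewrite cats0].
- split=> /=.
  + move=> i y z; rewrite cE; case: eqP => [->|_]; last exact: (inv_separated inv).
    rewrite !inE => /orP[/eqP ->|yj] /orP[/eqP ->|zj]; rewrite ?eqxx //.
    * by rewrite metric_sym => _; apply: far.
    * by move=> _; apply: far.
    * exact: (inv_separated inv).
  + move=> i; rewrite cE; case: eqP => _; rewrite ?(inv_uniq inv) //=.
    rewrite (inv_uniq inv) andbT; apply/negP => /far.
    by rewrite dxx leNgt pow_gt0.
  + move=> i y; rewrite cE; case: eqP => [->|_]; last exact: (inv_active inv).
    by rewrite inE => /orP[/eqP ->//|]; apply: inv_active.
  + move=> i e /(inv_parents inv) [? ? ? ?]; split=> //; exact: sub.
  + exact: inv_uniq_parents inv.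
  + move=> i b; rewrite /= /update; case: eqP => [_|_]; last exact: (inv_blocks inv).
    rewrite inE => /orP[/eqP -> y z|]; last exact: (inv_blocks inv).
    by rewrite !inE => /eqP -> /eqP ->; apply: connect0.
  + apply: le_trans (inv_cost inv) _; rewrite -[leLHS]addr0.
    apply: (ler_sum_change (active_lt xact)) => [i ij|].
      by rewrite /credit cE /= (update_neq _ _ ij) (negPf ij).
    (* A new center is its own block, so the difference of centers and blocks, hence the credit, is
       unchanged. *)
    rewrite /credit cE eqxx /= update_eq /= addr0 -!natr1 !opprD addrACA subrr addr0.
    exact: lexx.
- by rewrite cE eqxx mem_head.
- by rewrite dxx.
Qed.

Lemma linkP ps j y c st :
  invariant ps st -> y \in centers st j -> c \in centers st j.+1 ->
  d y c <= 6 * 4 ^+ j -> y \notin unzip1 (parents st j) ->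
  invariant ps (link j y c st) /\ extends st (link j y c st).
Proof.
move=> inv yj cj dyc ynew.
have ext : extends st (link j y c st).
  by split=> [i u //|]; exists [:: (y, c)]; rewrite cats1.
split=> //; split=> //=.
- exact: inv_separated inv.
- exact: inv_uniq inv.
- exact: inv_active inv.
- have old i e : e \in parents st i -> [/\ e.1 \in centers st i, e.2 \in centers st i.+1,
      d e.1 e.2 <= 6 * 4 ^+ i & linked (rcons (bought st) (y, c)) e.1 e.2].
    by move=> /(inv_parents inv)[? ? ? /(extends_linked ext)].
  move=> i e; rewrite /update; case: eqP => [->|_]; last exact: old.
  rewrite inE => /orP[/eqP ->|]; last exact: old.
  by split=> //=; apply: linked_edge; rewrite mem_rcons mem_head.
- move=> i; rewrite /update; case: eqP => _; rewrite ?(inv_uniq_parents inv) //=.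
  by rewrite ynew (inv_uniq_parents inv).
- by move=> i b bi u v ub vb; apply: (extends_linked ext); apply: (inv_blocks inv) bi _ _ ub vb.
- rewrite cost_rcons (le_trans (lerD (inv_cost inv) dyc)) //.
  apply: (ler_sum_change (active_lt (inv_active inv yj))) => [i ij|].
    by rewrite /credit /= update_neq.
  rewrite /credit /= update_eq /= -!natr1.
  rewrite le_eqVlt; apply/orP; left; apply/eqP; rewrite /centers /=.
  by ring.
Qed.

Lemma climbP ps n x st (r := climb d n x st) :
  invariant ps st -> active ps n x ->
  [/\ invariant ps r.1, r.2 \in centers r.1 n, d r.2 x <= 2 * 4 ^+ n,
      linked (bought r.1) r.2 x & extends st r.1].
Proof.
rewrite {}/r; elim: n => [|n IH] inv xact.
  have [inv' r0 dr ext _] := settleP inv xact; split=> //.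
    by move: dr; rewrite /= expr0; lra.
  (* The radius of level 0 is 1, the least distance between distinct vertices, so [x] can only
     settle at itself. *)
  suff -> : (settle d 0 x st).2 = x by apply: connect0.
  apply/eqP/negPn/negP => /d_min; move: dr; rewrite expr0; lra.
have [{}inv yn dyx yx ext] := IH inv (activeS xact).
move: inv yn dyx yx ext; rewrite /=; case: (climb d n x st) => [st' y] /= inv yn dyx yx ext.
have pow_gt0 : 0 < 4 ^+ n :> R by rewrite exprn_gt0.
rewrite /climb1 /=; case E: [seq _ <- _ | _] => [|e s] /=; last first.
  have : e \in [seq e <- parents st' n | d e.1 y == 0] by rewrite E mem_head.
  rewrite mem_filter metric_eq0 => /andP[/eqP e1 /(inv_parents inv)[_ e2 de le]].
  split=> //; last by apply: connect_trans yx; rewrite -e1 [connect _ _ _]linked_sym.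
  (* An old parent is within [6 * 4 ^+ n] of [y], which is within [2 * 4 ^+ n] of [x]; the sum is
     [2 * 4 ^+ n.+1]. *)
  rewrite (le_trans (metric_tri y _ _)) // metric_sym -e1 exprS; move: dyx; rewrite -e1; lra.
have ynew : y \notin unzip1 (parents st' n).
  apply/mapP => -[e en ye].
  have : e \in [seq e <- parents st' n | d e.1 y == 0].
    by rewrite mem_filter metric_eq0 ye eqxx.
  by rewrite E.
have [inv' cn dcx ext' par'] := settleP inv xact.
move: inv' cn dcx ext' par'; rewrite /=; case: (settle d n.+1 x st') => [st2 c] /= inv' cn dcx ext' par'.
(* Through [x]: [2 * 4 ^+ n] plus the settling radius [4 ^+ n.+1]. *)
have dyc : d y c <= 6 * 4 ^+ n.
  rewrite (le_trans (metric_tri x _ _)) // [d x c]metric_sym.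
  by move: dcx; rewrite exprS; lra.
have [||inv2 ext2] := linkP inv' _ cn dyc; rewrite ?par' //; first exact: ext'.1.
split=> //.
- by move: dcx; rewrite exprS; lra.
- apply: connect_trans (extends_linked (extends_trans ext' ext2) yx).
  rewrite -/(linked _ _ _) linked_sym; apply: linked_edge.
  by rewrite mem_rcons mem_head.
- exact: extends_trans (extends_trans ext ext') ext2.
Qed.

Lemma holdsE x b : holds d x b = (x \in b).
Proof.
rewrite /holds; apply/hasP/idP => [[c cb]|xb].
  by rewrite metric_eq0 => /eqP <-.
by exists x; rewrite // metric_eq0.
Qed.

Lemma fuseP ps j y z st :
  invariant ps st -> y \in centers st j -> z \in centers st j ->
  d y z <= 8 * 4 ^+ j ->
  [/\ invariant ps (fuse d j y z st), extends st (fuse d j y z st) &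
      linked (bought (fuse d j y z st)) y z].
Proof.
move=> inv yj zj dyz; rewrite /fuse.
rewrite (@eq_has _ _ (fun b : seq V => (y \in b) && (z \in b))); last by move=> b; rewrite !holdsE.
case: ifPn => [/hasP[b bj /andP[yb zb]]|no].
  split=> //; first exact: extends_refl.
  exact: (inv_blocks inv) bj _ _ yb zb.
pose P (b : seq V) := (y \in b) || (z \in b).
rewrite (@eq_filter _ (fun b => holds d y b || holds d z b) P); last first.
  by move=> b; rewrite !holdsE.
rewrite (@eq_filter _ (fun b => ~~ (holds d y b || holds d z b)) (predC P)); last first.
  by move=> b; rewrite !holdsE.
set st' := State _ _ _.
have perm_c i : perm_eq (centers st' i) (centers st i).
  rewrite /centers /= /update; case: eqP => [->|_] //=.
  rewrite -flatten_cat; apply: perm_flatten; exact: permEl (perm_filterC P _).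
have cE i : centers st' i =i centers st i by move=> u; apply: perm_mem.
have ext : extends st st'.
  by split=> [i u|]; [rewrite cE | exists [:: (y, z)]; rewrite cats1].
have yz : linked (bought st') y z.
  by apply: linked_edge; rewrite mem_rcons mem_head.
split=> //; split=> //=.
- by move=> i u v; rewrite !cE; apply: inv_separated inv _ _ _.
- by move=> i; rewrite (perm_uniq (perm_c i)) (inv_uniq inv).
- by move=> i u; rewrite cE; apply: inv_active inv _ _.
- by move=> i e /(inv_parents inv)[? ? ? /(extends_linked ext)]; rewrite !cE.
- exact: inv_uniq_parents inv.
- have old i b : b \in blocks st i -> {in b &, forall u v, linked (bought st') u v}.
    by move=> bi u v ub vb; apply: (extends_linked ext); apply: (inv_blocks inv) bi _ _ ub vb.
  move=> i b; rewrite /= /update; case: eqP => [_|_]; last exact: old.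
  rewrite inE => /orP[/eqP ->|]; last by rewrite mem_filter => /andP[_]; apply: old.
  have to_y u : u \in flatten [seq b <- blocks st j | P b] -> linked (bought st') u y.
    case/flattenP => b'; rewrite mem_filter => /andP[/orP[yb|zb] bj] ub.
      exact: old bj _ _ ub yb.
    by apply: connect_trans (old _ _ bj _ _ ub zb) _; rewrite -/(linked _ _ _) linked_sym.
  move=> u v /to_y uy /to_y vy; apply: connect_trans uy _.
  by rewrite -/(linked _ _ _) linked_sym.
- rewrite cost_rcons (le_trans (lerD (inv_cost inv) dyz)) //.
  apply: (ler_sum_change (active_lt (inv_active inv yj))) => [i ij|].
    by rewrite /credit (perm_size (perm_c i)) /= update_neq.
  (* No block holds both [y] and [z], so at least two blocks become one and the credit grows by at
     least [8 * 4 ^+ j]. *)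
  have szB : ((size (blocks st' j)).+1 <= size (blocks st j))%N.
    rewrite /= update_eq /= -(count_predC P (blocks st j)) !size_filter -addn2 addnC leq_add2r.
    case/flattenP: yj => b1 b1j yb1; case/flattenP: zj => b2 b2j zb2.
    have b12 : b1 != b2.
      apply: contraNneq no => b12; apply/hasP; exists b1 => //.
      by rewrite yb1 b12 zb2.
    rewrite -size_filter; apply: (@leq_trans (size [:: b1; b2])) => //.
    apply: uniq_leq_size => [|b]; first by rewrite /= inE b12.
    by rewrite !inE mem_filter /P => /orP[]/eqP ->; rewrite ?yb1 ?zb2 ?orbT.
  rewrite /credit (perm_size (perm_c j)) [parents st' j]/=.
  have {}szB : (size (blocks st' j))%:R + 1 <= (size (blocks st j))%:R :> R.
    by rewrite natr1 ler_nat.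
  rewrite [X in _ + X]mulrC -mulrDr ler_pM2l ?exprn_gt0 //; lra.
Qed.

(** Powers of 4 are integers, so truncating the distance does not change which of them it
    reaches. *)
Lemma levelP s t : s != t -> 4 ^+ level d s t <= d s t < 4 ^+ (level d s t).+1.
Proof.
move=> st; have dst := d_min st.
have /andP[le1 lt1] := truncn_itv (metric_ge0 s t).
have m_gt0 : (0 < Num.truncn (d s t))%N.
  by rewrite -(ltr_nat R); move: lt1; rewrite -natr1; lra.
have /andP[le2 lt2] := trunc_log_bounds (isT : 1 < 4)%N m_gt0.
apply/andP; split.
  by rewrite (le_trans _ le1) // -natrX ler_nat.
by rewrite (lt_le_trans lt1) // -natrX ler_nat.
Qed.

Lemma serveP ps p st :
  invariant ps st ->
  [/\ invariant (rcons ps p) (serve d st p), extends st (serve d st p) &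
      linked (bought (serve d st p)) p.1 p.2].
Proof.
move=> inv0.
have {inv0} inv : invariant (rcons ps p) st.
  case: inv0 => ? ? act *; split=> // j x xj; apply: (@active_sub ps) => [q|].
    by rewrite mem_rcons inE orbC => ->.
  exact: act xj.
rewrite /serve metric_eq0; case: ifPn => [/eqP ->|st12].
  by split=> //; [apply: extends_refl | apply: connect0].
have /andP[L1 L2] := levelP st12.
set L := level _ _ _ in L1 L2 *.
have act1 : active (rcons ps p) L p.1.
  by exists p; rewrite ?mem_rcons ?mem_head // eqxx.
have act2 : active (rcons ps p) L p.2.
  by exists p; rewrite ?mem_rcons ?mem_head // eqxx orbT.
have [{}inv yL dy ly ext1] := climbP inv act1.
move: inv yL dy ly ext1; rewrite /=; case: (climb d L p.1 st) => [st1 y] /= inv yL dy ly ext1.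
have [{}inv zL dz lz ext2] := climbP inv act2.
move: inv zL dz lz ext2; rewrite /=; case: (climb d L p.2 st1) => [st2 z] /= inv zL dz lz ext2.
(* The bound 8 is 2 + 4 + 2: from [y] to [p.1], across the pair at less than [4 ^+ L.+1], and from
   [p.2] to [z]. *)
have [|{}inv ext3 lyz] := fuseP inv (ext2.1 _ _ yL) zL.
  rewrite (le_trans (metric_tri p.1 _ _)) //.
  have := metric_tri p.2 p.1 z; rewrite [d p.2 z]metric_sym.
  by move: L2; rewrite exprS; lra.
split=> //; first by apply: extends_trans ext3; apply: extends_trans ext2.
have ly' := extends_linked (extends_trans ext2 ext3) ly.
have lz' := extends_linked ext3 lz.
apply: connect_trans lz'; apply: connect_trans lyz.
by rewrite -/(linked _ _ _) linked_sym.
Qed.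

Lemma outcome_rcons ps p : outcome d (rcons ps p) = serve d (outcome d ps) p.
Proof. by rewrite /outcome foldl_rcons. Qed.

Lemma outcomeP ps :
  invariant ps (outcome d ps) /\
  {in ps, forall p, linked (bought (outcome d ps)) p.1 p.2}.
Proof.
elim/last_ind: ps => [|ps p [inv IH]].
  split=> //; split=> //; rewrite /cost big_nil big1 // => j _.
  by rewrite /credit /= subrr !mulr0 addr0 mulr0.
have [inv' ext lp] := serveP p inv; rewrite outcome_rcons; split=> // q.
by rewrite mem_rcons inE => /orP[/eqP -> //|/IH]; apply: extends_linked.
Qed.

(** Here 14 is 6 + 8: each center has at most one parent edge, and merges number at most the
    centers. *)
Lemma outcome_cost ps : cost d (bought (outcome d ps)) <=
  14 * \sum_(j < J) 4 ^+ j * (size (centers (outcome d ps) j))%:R.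
Proof.
have [inv _] := outcomeP ps; apply: le_trans (inv_cost inv) _.
rewrite mulr_sumr ler_sum // => j _; rewrite /credit.
rewrite mulrCA ler_pM2l ?exprn_gt0 //.
have : (size (parents (outcome d ps) j) <= size (centers (outcome d ps) j))%N.
  rewrite -(size_map fst); apply: uniq_leq_size; first exact: inv_uniq_parents inv _.
  by move=> y /mapP[e /(inv_parents inv)[e1 _ _ _] ->].
rewrite -(ler_nat R); have := ler0n R (size (blocks (outcome d ps) j)).
lra.
Qed.

End Invariant.

(** * Cuts and random orders *)

Lemma walk_crossing (V : finType) (H : multigraph V) (C : pred V) p x :
  is_walk x p -> C x != C (last x (unzip2 p)) ->
  exists2 e, e \in unzip1 p &
    C (tnth (in_tuple H) e).1 != C (tnth (in_tuple H) e).2.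
Proof.
elim: p x => [|[e v] p IH] x /=; first by rewrite eqxx.
case/andP=> exv vp; have [Cxv|Cxv] := eqVneq (C x) (C v); last first.
  move=> _; exists e; first by rewrite inE eqxx.
  by case/orP: exv => /eqP -> /=; rewrite // eq_sym.
by rewrite Cxv => /(IH v vp)[e' e'p Ce']; exists e'; rewrite // inE e'p orbT.
Qed.

(** Each path crosses the cut, and disjointness makes the choice of a crossing copy injective. *)
Lemma disjoint_paths_crossing (V : finType) (H : multigraph V) (C : pred V)
    r s t :
  edge_disjoint_paths H r s t -> C s != C t ->
  (r <= count (fun e => C e.1 != C e.2) H)%N.
Proof.
case=> P [Ppath Pdisj] Cst.
have /fin_all_exists[g gP] i : exists e : edge_copy H, e \in unzip1 (P i) /\
    C (tnth (in_tuple H) e).1 != C (tnth (in_tuple H) e).2.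
  case/and3P: (Ppath i) => walk /eqP last_t _.
  have [|e ? ?] := walk_crossing walk (C := C); first by rewrite last_t.
  by exists e.
have g_inj : injective g.
  move=> i j gij; apply/eqP/negPn/negP => /Pdisj/(_ (g i)).
  by rewrite {2}gij !(gP _).1.
rewrite -sum1_count (big_tnth _ _ H) sum1_card -[leqLHS]card_ord.
rewrite -(card_codom g_inj); apply: subset_leq_card.
by apply/fintype.subsetP => e /codomP[i ->]; exact: (gP i).2.
Qed.

Lemma leq_sum_pow2 (P : pred nat) (n M : nat) :
  (forall l, P l -> 2 ^ l <= M)%N -> (\sum_(l < n) P l * 2 ^ l <= 2 * M)%N.
Proof.
move=> PM.
have le n' : (\sum_(l < n') P l * 2 ^ l <= 2 ^ n')%N.
  elim: n' => [|n' IH]; first by rewrite big_ord0.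
  by rewrite big_ord_recr /= expnS mul2n -addnn leq_add //; case: (P n'); rewrite ?mul1n.
elim: n => [|n IH]; first by rewrite big_ord0.
(* If the top index is selected, all lower terms together are at most [2 ^ n], itself at most
   [M]. *)
rewrite big_ord_recr /=; case: (boolP (P n)) => [/PM Pn|_]; last by rewrite addn0.
by rewrite mul1n mul2n -addnn leq_add // (leq_trans (le n)).
Qed.

Lemma up_log2_le (r : nat) : (0 < r)%N -> (2 ^ up_log 2 r <= 2 * r)%N.
Proof.
case: r => [|[|r]] // _; have /andP[+ _] := up_log_bounds (isT : 1 < 2)%N (isT : 1 < r.+2)%N.
have : (0 < up_log 2 r.+2)%N by rewrite up_log_gt0.
by case: (up_log 2 r.+2) => //= k _ /ltnW; rewrite expnS leq_mul2l.
Qed.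

Lemma separated_sum (V K : finType) (phi : V -> K) (H : multigraph V)
    (qs : seq (request V)) (n : nat) (N : nat -> seq V) :
  satisfies H qs -> (forall l, uniq (map phi (N l))) ->
  (forall l, {in N l, forall x, exists s t r,
    [/\ (s, t, r) \in qs, up_log 2 r = l, (0 < r)%N, (x == s) || (x == t)
      & phi s != phi t]}) ->
  (\sum_(l < n) 2 ^ l * size (N l)
     <= 8 * count (fun e => phi e.1 != phi e.2) H)%N.
Proof.
move=> Hqs phi_uniq N_pairs.
pose cut c := count (fun e => (phi e.1 == c) != (phi e.2 == c)) H.
(* A center in part [c] has a pair with exactly one end in [c], so [r] edges leave [c]. One factor 2
   is the rounding of [r], the other the geometric sum over classes. *)
have cutP c : (\sum_(l < n) (c \in map phi (N l)) * 2 ^ l <= 2 * (2 * cut c))%N.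
  apply: (@leq_sum_pow2 (fun l => c \in map phi (N l))) => l /mapP[x xN ->].
  have [s [t [r [q lr r0 xst pst]]]] := N_pairs _ _ xN.
  rewrite -lr (leq_trans (up_log2_le r0)) // leq_mul2l /=.
  apply: (disjoint_paths_crossing (C := fun v => phi v == phi x) (Hqs _ _ _ q)).
  by case/orP: xst => /eqP ->; rewrite eqxx; rewrite ?[phi t == _]eq_sym (negPf pst).
have -> : (\sum_(l < n) 2 ^ l * size (N l) =
    \sum_(c : K) \sum_(l < n) (c \in map phi (N l)) * 2 ^ l)%N.
  rewrite exchange_big; apply: eq_bigr => l _ /=.
  rewrite -big_distrl /= mulnC; congr (_ * _)%N.
  rewrite -(size_map phi) -(card_uniqP (phi_uniq l)) -sum1_card big_mkcond /=.
  by apply: eq_bigr => c _; case: (_ \in _).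
apply: leq_trans (leq_sum _ (fun c _ => cutP c)) _.
rewrite -2!big_distrr /= -[8%N]/(2 * (2 * 2))%N -!mulnA !leq_mul2l /=.
rewrite -sum1_count big_distrr /=.
under eq_bigr do rewrite /cut -sum1_count big_mkcond.
rewrite exchange_big [leqRHS]big_mkcond /=; apply: leq_sum => e _.
case: eqVneq => [->|ne]; first by rewrite big1 // => c _; rewrite eqxx.
(* A cut edge leaves exactly the two parts of its ends, which is the last factor 2 in 8. *)
rewrite (bigD1 (phi e.1)) //= (bigD1 (phi e.2)) 1?eq_sym //= big1 ?addn0.
  by case: ifP; case: ifP.
by move=> c /andP[c1 c2]; rewrite ![_ == c]eq_sym (negPf c1) (negPf c2).
Qed.

Section RandomOrder.
Variable V : finType.

Definition rank (s : {perm V}) (t : V) : nat := enum_rank (s t).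

Lemma rank_inj s : injective (rank s).
Proof. by move=> x y /val_inj /enum_rank_inj /perm_inj. Qed.

Definition first_in (B : {set V}) (s : {perm V}) (t : V) : bool :=
  [forall t' in B, rank s t <= rank s t']%N.

(* By symmetry each element of [B] comes first equally often. *)
Lemma card_first_in (B : {set V}) (t : V) : t \in B ->
  (#|B| * #|[set s | first_in B s t]| <= #|{perm V}|)%N.
Proof.
move=> tB.
have cardE t' : t' \in B ->
    #|[set s | first_in B s t]| = #|[set s | first_in B s t']|.
  (* Composing with the transposition of [t] and [t'] maps the orders with [t] first onto those with
     [t'] first. *)
  move=> t'B; rewrite -(card_imset _ (mulgI (tperm t t'))).
  have tpermB x : x \in B -> tperm t t' x \in B by case: tpermP => [->|->|].
  congr #|pred_of_set _|; apply/finset.setP => s; apply/imsetP/idP => [[s' + ->]|].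
    rewrite !inE => /forall_inP ft; apply/forall_inP => x xB.
    by rewrite /rank !permM tpermR; apply: ft; apply: tpermB.
  rewrite inE => /forall_inP ft; exists (tperm t t' * s)%g; last first.
    by rewrite mulgA tperm2 mul1g.
  rewrite inE; apply/forall_inP => x xB.
  by rewrite /rank !permM tpermL; apply: ft; apply: tpermB.
rewrite -sum_nat_const (eq_bigr _ cardE).
under eq_bigr do rewrite -sum1_card big_mkcond.
rewrite exchange_big -sum1_card /=; apply: leq_sum => s _.
(* A given order [s] has at most one first element of [B], so it is counted at most once. *)
case: (boolP [exists t' in B, first_in B s t']) => [/exists_inP[t' t'B ft']|].
  rewrite (bigD1 t') //= big1 ?addn0; first by case: ifP.
  move=> x /andP[xB xt']; rewrite inE; case: ifP => // /forall_inP fx.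
  case/eqP: xt'; apply: (@rank_inj s); apply/eqP.
  by rewrite eqn_leq fx //=; move/forall_inP: ft'; apply.
rewrite negb_exists_in => /forall_inP no; rewrite big1 // => x /no.
by rewrite inE => /negPf ->.
Qed.

End RandomOrder.

(** Remove a maximizer [t0] of [f]: its own term is the inverse of [#|A|], and the other terms can
    only grow. Ties only make terms smaller. *)
Lemma sum_inv_rank_le (R : realType) (T : finType) (f : T -> R) (A : {set T}) :
  \sum_(t in A) (#|[set t' in A | f t' <= f t]|%:R)^-1
    <= \sum_(i < #|A|) i.+1%:R^-1 :> R.
Proof.
have [n] := ubnP #|A|; elim: n A => // n IH A szA.
have [->|[a aA]] := set_0Vmem A; first by rewrite big_set0 cards0 big_ord0.
have [t0 t0A' t0max] := arg_maxP f aA; have {t0A'} t0A : t0 \in A := t0A'.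
rewrite (big_setD1 t0) //= (cardsD1 t0 A) t0A add1n big_ord_recr /= addrC.
apply: lerD.
  apply: le_trans (IH (A :\ t0) _); last by move: szA; rewrite (cardsD1 t0) t0A.
  apply: ler_sum => t tA.
  have t_in : t \in [set t' in A :\ t0 | f t' <= f t] by rewrite inE tA lexx.
  rewrite lef_pV2 ?posrE ?ltr0n ?card_gt0; last 2 first.
  - by apply/finset.set0Pn; exists t; move: t_in; rewrite !inE => /andP[/andP[_ ->] ->].
  - by apply/finset.set0Pn; exists t.
  rewrite ler_nat; apply/subset_leq_card/fintype.subsetP => x.
  by rewrite !inE => /andP[/andP[_ ->] ->].
suff -> : [set t' in A | f t' <= f t0] = A by rewrite (cardsD1 t0 A) t0A.
by apply/finset.setP => t; rewrite inE; case: (boolP (t \in A)) => //= /t0max.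
Qed.

Lemma count_nat_interval (R : realType) (a D : R) (M : nat) : 0 <= a -> 0 <= D ->
  \sum_(m < M) ((a <= m%:R) && (m%:R < a + D))%:R <= D + 1.
Proof.
move=> a0 D0; set F := fun m : nat => ((a <= m%:R) && (m%:R < a + D))%:R : R.
have low k : (a <= k%:R -> \sum_(m < k) F m <= k%:R - a) /\
    (k%:R < a -> \sum_(m < k) F m = 0).
  elim: k => [|k [IH1 IH2]]; first by rewrite !big_ord0; split=> //; lra.
  rewrite big_ord_recr /= -natr1; split=> [ak|ka].
    have [/[dup] ak' /IH1|/[dup] ka /IH2 ->] := leP a k%:R.
      have F1 : F k <= 1 by rewrite /F lern1 leq_b1.
      by move=> Sk; rewrite addrAC lerD.
    by rewrite /F (lt_geF ka) /=; lra.
  have {}ka : k%:R < a by lra.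
  by rewrite IH2 // /F (lt_geF ka) addr0.
elim: M => [|M IH]; first by rewrite big_ord0; lra.
rewrite big_ord_recr /=; case: (boolP (_ && _)) => [/andP[aM Ma]|_].
  have SM : \sum_(m < M) F m <= D by rewrite (le_trans ((low M).1 aM)) //; lra.
  by rewrite lerD.
by rewrite addr0.
Qed.

(** * Random ball partitions *)

Definition harmonic_sum (R : realType) (k : nat) : R :=
  \sum_(i < k) i.+1%:R^-1.

Section BallPartition.
Variables (R : realType) (V : finType) (d : V -> V -> R) (A : {set V}).
Hypothesis d_metric : is_metric d.
Hypothesis d_min : forall u v, u != v -> 1 <= d u v.

Definition near (m : nat) (v : V) : {set V} := [set t in A | d t v <= m%:R].

(** The parts of the partition are the fibers of this map; vertices with no element of [A] within
    [m] all share the part [None]. *)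
Definition ball_center (m : nat) (s : {perm V}) (v : V) : option V :=
  [pick t in near m v | first_in (near m v) s t].

Lemma first_in_uniq (B : {set V}) s t t' : t \in B -> t' \in B ->
  first_in B s t -> first_in B s t' -> t = t'.
Proof.
move=> tB t'B /forall_inP ft /forall_inP ft'; apply: (@rank_inj _ s).
by apply/eqP; rewrite eqn_leq ft ?ft'.
Qed.

Lemma first_in_ex (B : {set V}) s x : x \in B -> exists2 t, t \in B & first_in B s t.
Proof.
move=> xB; have [t tB tmin] := @arg_minnP _ x (mem B) (rank s) xB.
by exists t => //; apply/forall_inP.
Qed.

Lemma ball_center_eq m s v t : t \in near m v -> first_in (near m v) s t ->
  ball_center m s v = Some t.
Proof.
move=> tv ft; rewrite /ball_center; case: pickP => [t' /andP[t'v ft']|/(_ t)].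
  by congr Some; apply: first_in_uniq ft' ft.
by rewrite tv ft.
Qed.

(** Both vertices lie within [m] of one center; the premise on [u] excludes the part [None], whose
    diameter is not controlled. *)
Lemma ball_center_near m s u v : u \in near m u -> ball_center m s u = ball_center m s v ->
  d u v <= 2 * m%:R.
Proof.
move=> /(first_in_ex s)[t tu ft]; rewrite (ball_center_eq tu ft) /ball_center.
case: pickP => // t' /andP[tv _] [tt']; rewrite -{t'}tt' in tv.
rewrite (le_trans (metric_tri d_metric t _ _)) // (metric_sym d_metric u).
by move: tu tv; rewrite !inE => /andP[_ ?] /andP[_ ?]; lra.
Qed.

Lemma ball_center_cut m s u v (delta := fun t => Num.min (d t u) (d t v)) :
  ball_center m s u != ball_center m s v ->
  exists2 t, t \in A & [&& delta t <= m%:R, m%:R < delta t + d u v &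
    first_in [set t' in A | delta t' <= delta t] s t].
Proof.
have subu : near m u \subset [set t in A | delta t <= m%:R].
  by apply/fintype.subsetP => t; rewrite !inE => /andP[-> tu]; rewrite ge_min tu.
have subv : near m v \subset [set t in A | delta t <= m%:R].
  by apply/fintype.subsetP => t; rewrite !inE => /andP[-> tv]; rewrite ge_min tv orbT.
have first_sub (B B' : {set V}) t : B \subset B' -> first_in B' s t -> first_in B s t.
  by move=> /fintype.subsetP BB' /forall_inP ft; apply/forall_inP => x /BB' /ft.
have [E|[x xB]] := set_0Vmem [set t in A | delta t <= m%:R].
  move: subu subv; rewrite E !finset.subset0 /ball_center => /eqP -> /eqP ->.
  by rewrite eqxx.
(* Take the first [t] within [m] of [u] or [v]. Were it within [m] of both, it would be the center
   of both; so [m] is below the larger distance, itself at most [delta t + d u v]. *)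
have [t tB ft] := first_in_ex s xB; have := tB; rewrite inE => /andP[tA tm].
move=> cut; exists t => //; rewrite tm /=; apply/andP; split; last first.
  apply: first_sub ft; apply/fintype.subsetP => y; rewrite !inE => /andP[-> yt] /=.
  exact: le_trans tm.
rewrite ltNge; apply: contra cut => mt.
have tri1 := metric_tri d_metric u t v; have tri2 := metric_tri d_metric v t u.
rewrite (metric_sym d_metric v) in tri2.
have [tu tv] : d t u <= m%:R /\ d t v <= m%:R.
  have d0 := metric_ge0 d_metric d_min u v.
  by move: mt; rewrite /delta; case: (leP (d t u) (d t v)) => ? ?; split; lra.
by rewrite !(@ball_center_eq _ _ _ t) ?inE ?tA //; apply: first_sub ft.
Qed.

(** Union bound over the terminal [t] that cuts the edge: few radii fit its interval, and it comes
    first in [B t] for at most one order in [#|B t|]. Probabilities are kept as counts of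
    permutations. *)
Lemma expected_cut M u v :
  \sum_(m < M) \sum_(s : {perm V}) (ball_center m s u != ball_center m s v)%:R
    <= 2 * d u v * #|{perm V}|%:R * harmonic_sum R #|A|.
Proof.
have d0 : 0 <= d u v := metric_ge0 d_metric d_min u v.
have [->|uv] := eqVneq u v.
  rewrite big1 => [|m _]; last by rewrite big1 // => s _; rewrite eqxx.
  by rewrite !mulr_ge0 ?metric_ge0 ?sumr_ge0.
pose delta t := Num.min (d t u) (d t v).
pose B t := [set t' in A | delta t' <= delta t].
have delta0 t : 0 <= delta t by rewrite le_min !metric_ge0.
apply: (@le_trans _ _ (\sum_(m < M) \sum_(s : {perm V}) \sum_(t in A)
   ((delta t <= m%:R) && (m%:R < delta t + d u v))%:R * (first_in (B t) s t)%:R)).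
  apply: ler_sum => m _; apply: ler_sum => s _.
  case: eqP => [_|/eqP /ball_center_cut[t tA /and3P[tm mt ft]]].
    by rewrite sumr_ge0 // => t _; rewrite mulr_ge0.
  by rewrite (bigD1 t) //= tm mt ft mulr1 lerDl sumr_ge0 // => t' _; rewrite mulr_ge0.
under eq_bigr do rewrite exchange_big.
rewrite exchange_big /=.
have cost_t t : t \in A ->
    \sum_(m < M) \sum_(s : {perm V}) ((delta t <= m%:R) && (m%:R < delta t + d u v))%:R
      * (first_in (B t) s t)%:R <= 2 * d u v * #|{perm V}|%:R * #|B t|%:R^-1.
  move=> tA; under eq_bigr do rewrite -mulr_sumr.
  rewrite -mulr_suml -[leRHS]mulrA; apply: ler_pM; rewrite ?sumr_ge0 //.
  (* The [+ 1] from counting integers is absorbed because [d u v] is at least 1. *)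
  - by rewrite (le_trans (count_nat_interval _ _ _)) //; have := d_min uv; lra.
  - have tB : t \in B t by rewrite inE tA lexx.
    have B0 : 0 < #|B t|%:R :> R.
      by rewrite ltr0n card_gt0; apply/finset.set0Pn; exists t.
    rewrite ler_pdivlMr // mulrC -natr_sum -natrM ler_nat.
    apply: leq_trans (card_first_in tB); rewrite leq_mul2l; apply/orP; right.
    by rewrite -sum1_card [leqRHS]big_mkcond leq_sum // => s _; rewrite inE; case: ifP.
apply: le_trans (ler_sum _ cost_t) _; rewrite -mulr_sumr ler_wpM2l //.
  by rewrite !mulr_ge0.
exact: sum_inv_rank_le.
Qed.

Definition separated_centers (qs : seq (request V)) (l j : nat) (N : seq V) : Prop :=
  [/\ uniq N, {in N &, forall x y, x != y -> 4 ^+ j <= d x y} &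
      {in N, forall x, exists s t r, [/\ (s, t, r) \in qs, up_log 2 r = l,
        (x == s) || (x == t) & 4 ^+ j <= d s t]}].

(** The radii of level [j] stay below [4 ^ j.+1], so different levels use disjoint ranges and share
    one sum. *)
Lemma sum_blocks_le (f : nat -> R) (J : nat) : (forall m, 0 <= f m) ->
  \sum_(j < J) \sum_(4 ^ j <= m < 2 * 4 ^ j) f m <= \sum_(m < 4 ^ J) f m.
Proof.
move=> f0; elim: J => [|J IH]; first by rewrite big_ord0 sumr_ge0.
have le4 : (4 ^ J <= 2 * 4 ^ J <= 4 ^ J.+1)%N.
  by rewrite leq_pmull // expnS leq_mul2r orbT.
case/andP: le4 => le1 le2.
rewrite big_ord_recr /= -[leRHS](big_mkord xpredT) /=.
rewrite (big_cat_nat (leq0n (4 ^ J)) (leq_trans le1 le2)) /= big_mkord lerD //.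
by rewrite [leRHS](big_cat_nat le1 le2) /= lerDl sumr_ge0.
Qed.

Lemma count_metric_le (H : multigraph V) :
  (count (fun e => e.1 != e.2) H)%:R <= cost d H.
Proof.
rewrite /cost -sum1_count natr_sum big_mkcond /= ler_sum // => e _.
by case: ifP => [/d_min //|_]; apply: metric_ge0.
Qed.

Lemma sum_ball_cuts_le (H : multigraph V) M :
  \sum_(m < M) \sum_(s : {perm V})
      (count (fun e => ball_center m s e.1 != ball_center m s e.2) H)%:R
    <= 2 * #|{perm V}|%:R * harmonic_sum R #|A| * cost d H.
Proof.
rewrite /cost mulr_sumr.
have -> : \sum_(m < M) \sum_(s : {perm V})
      (count (fun e => ball_center m s e.1 != ball_center m s e.2) H)%:R =
    \sum_(e <- H) \sum_(m < M) \sum_(s : {perm V})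
      (ball_center m s e.1 != ball_center m s e.2)%:R :> R.
  rewrite [RHS]exchange_big; apply: eq_bigr => m _ /=.
  rewrite [RHS]exchange_big; apply: eq_bigr => s _ /=.
  by rewrite -sum1_count natr_sum big_mkcond; apply: eq_bigr => e _; case: ifP.
apply: ler_sum => e _; apply: le_trans (expected_cut _ _ _) _.
by rewrite le_eqVlt; apply/orP; left; apply/eqP; ring.
Qed.

Lemma separated_centers_le (qs : seq (request V)) (H : multigraph V) (n J : nat)
    (N : nat -> nat -> seq V) :
  satisfies H qs ->
  (forall s t r, (s, t, r) \in qs -> [/\ (0 < r)%N, s \in A & t \in A]) ->
  (forall l j, separated_centers qs l j (N l j)) ->
  \sum_(l < n) 2 ^+ l * \sum_(j < J.+1) 4 ^+ j * (size (N l j))%:R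
    <= (8 + 64 * harmonic_sum R #|A|) * cost d H.
Proof.
move=> Hqs qsA sepN.
pose W j := (\sum_(l < n) 2 ^ l * size (N l j))%N.
have -> : \sum_(l < n) 2 ^+ l * \sum_(j < J.+1) 4 ^+ j * (size (N l j))%:R =
    \sum_(j < J.+1) 4 ^+ j * (W j)%:R :> R.
  under eq_bigr do rewrite mulr_sumr.
  rewrite exchange_big; apply: eq_bigr => j _ /=.
  rewrite /W natr_sum mulr_sumr; apply: eq_bigr => l _.
  by rewrite natrM natrX mulrCA.
(* Level 0 needs no randomness: the partition into singletons already separates everything, and each
   cut edge costs at least 1. *)
rewrite big_ord_recl expr0 mul1r mulrDl lerD //.
  apply: (@le_trans _ _ (8 * (count (fun e : V * V => e.1 != e.2) H)%:R)).
    rewrite -natrM ler_nat; apply: (@separated_sum _ _ id _ _ _ (N^~ 0%N) Hqs) => l.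
      by rewrite map_id; case: (sepN l 0).
    move=> x; case: (sepN l 0) => _ _ /[apply] -[s [t [r [q lr xst dst]]]].
    exists s, t, r; split=> //; first by case: (qsA _ _ _ q).
    apply: contraTneq dst => ->.
    by rewrite expr0 (eqP (_ : d t t == 0)) ?(metric_eq0 d_metric) // ler10.
  by rewrite ler_wpM2l // count_metric_le.
(* Parts of terminals have diameter at most [2 * m], below [4 ^ j.+1], so centers and pairs of level
   [j.+1] are split for every order [s]. *)
have W_le j m s : (m < 2 * 4 ^ j)%N ->
    (W j.+1 <= 8 * count (fun e => ball_center m s e.1 != ball_center m s e.2) H)%N.
  move=> mj; have mjR : 2 * m%:R < 4 ^+ j.+1 :> R.
    by rewrite -natrX -natrM ltr_nat expnS; lia.
  have nearA x : x \in A -> x \in near m x.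
    by move=> xA; rewrite inE xA (eqP (_ : d x x == 0)) ?(metric_eq0 d_metric) /=.
  have far x y : x \in A -> 4 ^+ j.+1 <= d x y -> ball_center m s x != ball_center m s y.
    move=> /nearA xA; apply: contraTneq => /(ball_center_near xA) dxy.
    by rewrite -ltNge (le_lt_trans dxy).
  apply: (@separated_sum _ _ (ball_center m s) _ _ _ (N^~ j.+1) Hqs) => l; case: (sepN l j.+1) => uN sN aN.
    rewrite map_inj_in_uniq // => x y xN yN exy; apply/eqP/negPn/negP => /(sN _ _ xN yN).
    have xA : x \in A.
      have [s' [t' [r' [q' _ xst _]]]] := aN x xN; have [_ sA tA] := qsA _ _ _ q'.
      by case/orP: xst => /eqP ->.
    by move/(far _ _ xA)/eqP.
  move=> x /aN[s' [t' [r' [q' lr xst dst]]]]; have [r0 sA tA] := qsA _ _ _ q'.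
  by exists s', t', r'; split=> //; apply: far.
pose f m := \sum_(s : {perm V})
  (count (fun e => ball_center m s e.1 != ball_center m s e.2) H)%:R : R.
have P_gt0 : 0 < #|{perm V}|%:R :> R.
  by rewrite ltr0n; apply/card_gt0P; exists 1%g.
rewrite -(ler_pM2l P_gt0) mulr_sumr.
(* Summing [W_le] over the [4 ^ j] radii of a level accounts for its weight up to a factor 4; with
   the 8 of [W_le] this is 32. *)
apply: (@le_trans _ _ (32 * \sum_(j < J) \sum_(4 ^ j <= m < 2 * 4 ^ j) f m)).
  rewrite mulr_sumr; apply: ler_sum => j _.
  rewrite lift0.
  have -> : #|{perm V}|%:R * (4 ^+ j.+1 * (W j.+1)%:R) =
      4 * \sum_(4 ^ j <= m < 2 * 4 ^ j) \sum_(s : {perm V}) (W j.+1)%:R :> R.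
    rewrite !sumr_const_nat sumr_const mul2n -addnn addnK exprS.
    by rewrite -[(_ *+ _ *+ _)]mulr_natr -[(W _)%:R *+ _]mulr_natr natrX; ring.
  rewrite (_ : 32 = 4 * 8); last by ring.
  rewrite -mulrA ler_wpM2l // mulr_sumr big_nat [leRHS]big_nat.
  apply: ler_sum => m /andP[_ mj]; rewrite mulr_sumr; apply: ler_sum => s _.
  by rewrite -natrM ler_nat W_le.
have f0 m : 0 <= f m by apply: sumr_ge0.
apply: (@le_trans _ _ (32 * (2 * #|{perm V}|%:R * harmonic_sum R #|A| * cost d H))).
  by rewrite ler_wpM2l // (le_trans (sum_blocks_le J f0)) // sum_ball_cuts_le.
by rewrite le_eqVlt; apply/orP; left; apply/eqP; ring.
Qed.

End BallPartition.

Lemma harmonic_sum_ln (R : realType) (k : nat) :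
  (0 < k)%N -> harmonic_sum R k <= 1 + ln k%:R.
Proof.
elim: k => // -[_ _|k IH _].
  by rewrite /harmonic_sum big_ord_recl big_ord0 invr1 ln1 !addr0.
rewrite /harmonic_sum big_ord_recr /= -/(harmonic_sum R _).
apply: le_trans (lerD (IH isT) (lexx _)) _; rewrite -addrA lerD2l.
have k1 : 0 < k.+1%:R :> R by rewrite ltr0n.
have k2 : 0 < k.+2%:R :> R by rewrite ltr0n.
have E : k.+1%:R / k.+2%:R = 1 + - k.+2%:R^-1 :> R.
  rewrite -[k.+2%:R]natr1; move: (k.+1%:R : R) k1 => x x0.
  by field; rewrite gt_eqF // addr_gt0.
(* This is [ln (1 + x) <= x] at [x = - k.+2%:R^-1]. *)
have : ln (k.+1%:R / k.+2%:R) <= - k.+2%:R^-1 :> R.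
  by rewrite E; apply: le_ln1Dx; rewrite ltrN2 invf_lt1 // ltr1n.
rewrite ln_div ?posrE //; move: (ln _) (ln _) (_^-1) => a b c ?; lra.
Qed.

(** * The multigraph bought online *)

Lemma nth_occurrence (T : eqType) (a : T) (s : seq T) (c : nat) :
  (c < count_mem a s)%N ->
  exists2 i, (i < size s)%N & nth a s i = a /\ count_mem a (take i s) = c.
Proof.
elim: s c => //= x s IH c; have [->|xa] := eqVneq x a; last first.
  by move/IH => [i si [ia ic]]; exists i.+1 => //=; rewrite (negPf xa).
case: c => [_|c]; first by exists 0%N.
rewrite add1n ltnS => /IH[i si [ia ic]]; exists i.+1 => //=.
by rewrite eqxx ic add1n.
Qed.

Lemma linked_disjoint_paths (V : finType) (F : seq (V * V)) (H : multigraph V)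
    (r : nat) s t :
  linked F s t -> {in F, forall e, (r <= count_mem e H)%N} ->
  edge_disjoint_paths H r s t.
Proof.
case/connectP => p0 path0 last0 copies.
case/shortenP: path0 last0 => p path_p uniq_p _ {p0} last_p.
(* The [c]-th path only uses edge copies that are the [c]-th occurrence of
   their edge in [H]. *)
pose occ (e : edge_copy H) := count_mem (tnth (in_tuple H) e) (take e H).
have walkP (c : 'I_r) : exists P : seq (edge_copy H * V),
    [/\ is_walk s P, unzip2 P = p & {in unzip1 P, forall e, occ e = c}].
  elim: p s path_p {uniq_p last_p} => [|v p IH] u /=; first by exists [::].
  case/andP=> uv /IH[P [walkP PE occP]].
  have [a aF aE] : exists2 a, a \in F & (a == (u, v)) || (a == (v, u)).
    by case/orP: uv => ?; [exists (u, v) | exists (v, u)]; rewrite // eqxx ?orbT.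
  have [i iH [ia ic]] := nth_occurrence (leq_trans (ltn_ord c) (copies a aF)).
  have tnthE : tnth (in_tuple H) (Ordinal iH) = a by rewrite (tnth_nth a).
  exists ((Ordinal iH, v) :: P); split; rewrite /= ?PE //.
    by rewrite /joins tnthE aE.
  by move=> e; rewrite inE => /orP[/eqP ->|/occP //]; rewrite /occ tnthE.
have [P PP] := fin_all_exists walkP; exists P; split=> [i|i j ij e].
  by case: (PP i) => walk PE _; rewrite /is_path walk PE -last_p eqxx.
apply/negP => /andP[ei ej]; case/eqP: ij; apply: val_inj => /=.
have [_ _ /(_ e ei) <-] := PP i; by have [_ _ /(_ e ej) <-] := PP j.
Qed.

Definition steiner_algorithm (R : realType) : online_algorithm R := fun n w =>
  response (view_dist w)
    [seq (((i, false), (i, true)), view_requirement w i) | i <- enum 'I_n].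

Lemma sum_flatten_nseq (M : nmodType) (T : Type) (k : nat) (s : seq T) (g : T -> M) :
  \sum_(e <- flatten (nseq k s)) g e = (\sum_(e <- s) g e) *+ k.
Proof.
by elim: k => [|k IH] /=; rewrite ?big_nil // big_cat IH mulrS.
Qed.

Section Run.
Variables (R : realType) (V : finType) (d : V -> V -> R).

(** By naturality the run on names can be analyzed as a run on vertices. *)
Lemma bought_lastE (qs : seq (request V)) :
  bought_last (@steiner_algorithm R) d qs = response d qs.
Proof.
rewrite /bought_last /steiner_algorithm.
rewrite -/(map (map_pair (@vertex_of V qs)) _).
rewrite -(@response_map _ _ _ _ d (@vertex_of V qs)) // -map_comp.
have qsE : map (tnth (in_tuple qs)) (enum 'I_(size qs)) = qs by rewrite map_tnth_enum.
rewrite -[in RHS]qsE; congr response; apply: eq_map => i /=.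
by rewrite /map_pair /vertex_of /=; case: (tnth _ i) => [[]].
Qed.

Variable J : nat.
Hypothesis d_metric : is_metric d.
Hypothesis d_min : forall u v, u != v -> 1 <= d u v.
Hypothesis d_max : forall u v, d u v < 4 ^+ J.

(** Forests only grow at their end, so the [drop] in [response] yields exactly the new edges. *)
Lemma forest_rcons l (qs : seq (request V)) (q : request V) :
  exists F, forest d l (rcons qs q) = forest d l qs ++ F /\
    (up_log 2 q.2 != l -> F = [::]).
Proof.
rewrite /forest /class_pairs filter_rcons; case: eqP => [_|]; last first.
  by exists [::]; rewrite cats0.
rewrite map_rcons outcome_rcons.
have [inv _] := outcomeP d_metric d_min d_max [seq q.1 | q <- qs & up_log 2 q.2 == l].
have [_ [_ [F ->]] _] := serveP d_metric d_min d_max q.1 inv.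
by exists F.
Qed.

(** The weight [g] is kept general: edge length gives the cost, the indicator of an edge gives its
    number of copies. *)
Lemma sum_run (g : V * V -> R) (n : nat) (qs : seq (request V)) (i : nat) :
  {in qs, forall q, up_log 2 q.2 < n}%N -> (i <= size qs)%N ->
  \sum_(e <- run (@steiner_algorithm R) d qs i) g e =
  \sum_(l < n) (\sum_(e <- forest d l (take i qs)) g e) *+ 2 ^ l.
Proof.
move=> qsn; elim: i => [_|i IH iqs].
  by rewrite take0 /run /= big_nil big1 // => l _; rewrite mul0rn.
have [q0 _] : exists q, q \in qs by case: qs iqs {qsn IH} => // q *; exists q; rewrite mem_head.
have -> : run (@steiner_algorithm R) d qs i.+1 = run (@steiner_algorithm R) d qs i ++
    response d (take i.+1 qs).
  rewrite /run -addn1 iotaD map_cat flatten_cat /= cats0 add0n.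
  by rewrite bought_lastE addn1.
rewrite big_cat IH ?(ltnW iqs) //= (take_nth q0 iqs).
set q := nth q0 qs i; set ps := take i qs.
have qn : (up_log 2 q.2 < n)%N by apply: qsn; apply: mem_nth.
rewrite /response rev_rcons /= revK sum_flatten_nseq.
rewrite [RHS](bigD1 (Ordinal qn)) //= [X in X + _ = _](bigD1 (Ordinal qn)) //=.
have [F [-> _]] := forest_rcons (up_log 2 q.2) ps q.
rewrite drop_size_cat // big_cat /= mulrnDl addrAC; congr (_ + _ + _).
apply: eq_bigr => l lq; have [F' [-> ->]] := forest_rcons l ps q.
  by rewrite cats0.
by apply: contraNneq lq => lq; apply/eqP/val_inj.
Qed.

Lemma class_bound (qs : seq (request V)) :
  exists n, {in qs, forall q, up_log 2 q.2 < n}%N.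
Proof.
exists (\max_(q <- qs) up_log 2 q.2).+1 => q qqs; rewrite ltnS.
exact: (@leq_bigmax_seq _ qs xpredT (fun q : request V => up_log 2 q.2)).
Qed.

Lemma run_satisfies (qs : seq (request V)) (i : nat) :
  (forall s t r, (s, t, r) \in qs -> 0 < r)%N -> (i <= size qs)%N ->
  satisfies (run (@steiner_algorithm R) d qs i) (take i qs).
Proof.
move=> qs_gt0 iqs s t r q; pose l := up_log 2 r.
have [_ link] := outcomeP d_metric d_min d_max (class_pairs l (take i qs)).
have st : (s, t) \in class_pairs l (take i qs).
  by apply/mapP; exists (s, t, r); rewrite // mem_filter eqxx q.
apply: linked_disjoint_paths (link _ st) _ => e eF.
apply: leq_trans (up_logP r (isT : 1 < 2)%N) _.
have [n qsn] := class_bound qs.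
have countE (s' : seq (V * V)) : (count_mem e s')%:R = \sum_(x <- s') (x == e)%:R :> R.
  by rewrite -sum1_count natr_sum big_mkcond; apply: eq_bigr => x _ /=; case: (x == e).
have ln : (l < n)%N by apply: (qsn (s, t, r)); apply: mem_take q.
rewrite -(ler_nat R) countE (sum_run _ qsn iqs) (bigD1 (Ordinal ln)) //=.
rewrite -[leLHS]addr0 lerD ?sumr_ge0 // => [|l' _]; last by rewrite mulrn_wge0 ?sumr_ge0.
rewrite -countE -mulrnA ler_nat leq_pmull //.
by rewrite -has_count has_pred1.
Qed.

Lemma run_cost_le (qs : seq (request V)) (H : multigraph V) :
  (forall s t r, (s, t, r) \in qs -> 0 < r)%N -> satisfies H qs ->
  cost d (run (@steiner_algorithm R) d qs (size qs))
    <= 14 * (8 + 64 * harmonic_sum R (size (terminals qs))) * cost d H.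
Proof.
move=> qs_gt0 Hqs.
have [n qsn] := class_bound qs.
pose A := [set x in terminals qs].
have cardA : #|A| = size (terminals qs).
  by rewrite cardsE; apply/card_uniqP/undup_uniq.
(* [separated_centers_le] splits off level 0 and so sums over [J.+1] levels; the cost bound is taken
   with the same range. *)
have d_max' u v : d u v < 4 ^+ J.+1.
  by rewrite (lt_le_trans (d_max u v)) // ler_eXn2l ?ltr1n.
pose N l := centers (outcome d (class_pairs l qs)).
rewrite {1}/cost (sum_run (fun e => d e.1 e.2) qsn) // take_size -cardA -mulrA.
apply: (@le_trans _ _ (14 * \sum_(l < n) 2 ^+ l * \sum_(j < J.+1) 4 ^+ j * (size (N l j))%:R)).
  rewrite mulr_sumr ler_sum // => l _.
  rewrite -[leLHS]mulr_natl natrX mulrCA ler_pM2l ?exprn_gt0 //.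
  exact: (outcome_cost d_metric d_min d_max').
rewrite ler_wpM2l //; apply: (separated_centers_le d_metric d_min n J Hqs).
  move=> s t r q; split; first exact: qs_gt0 q.
    by rewrite inE mem_undup; apply/flatten_mapP; exists (s, t, r); rewrite // !inE eqxx.
  by rewrite inE mem_undup; apply/flatten_mapP; exists (s, t, r); rewrite // !inE eqxx orbT.
move=> l j; have [inv _] := outcomeP d_metric d_min d_max' (class_pairs l qs).
split; [exact: (inv_uniq inv) | exact: (inv_separated inv) |].
move=> x /(inv_active inv)[p /mapP[[[s t] r]]].
rewrite mem_filter => /andP[/eqP lr q] -> /andP[xp dst].
by exists s, t, r.
Qed.

End Run.

(** * Bounded distances and the competitive ratio *)

Lemma metric_bounded (R : realType) (V : finType) (d : V -> V -> R) :
  (forall u v, 0 <= d u v) -> exists J, forall u v, d u v < 4 ^+ J.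
Proof.
move=> d0; pose D := \sum_u \sum_v d u v.
have D0 : 0 <= D by do 2![apply: sumr_ge0 => ? _].
exists (Num.bound D) => u v.
have uvD : d u v <= D.
  rewrite /D (bigD1 u) //= (bigD1 v) //= -addrA lerDl addr_ge0 // sumr_ge0 // => *.
  exact: sumr_ge0.
apply: le_lt_trans uvD (lt_trans (archi_boundP D0) _).
by rewrite -natrX ltr_nat ltn_expl.
Qed.

Theorem theorem1p1 (R : realType) :
  exists A : online_algorithm R,
    solves_steiner_network A /\ log_competitive A.
Proof.
have bounded (V : finType) (d : V -> V -> R) : is_metric d -> min_edge_length1 d ->
    (forall u v, u != v -> 1 <= d u v) /\ exists J, forall u v, d u v < 4 ^+ J.
  move=> d_metric [_ d_min]; split=> //.
  by apply: metric_bounded => u v; apply: metric_ge0.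
exists (@steiner_algorithm R); split.
  move=> V d qs [d_metric d_edge qs_gt0] i iqs.
  have [d_min [J d_max]] := bounded V d d_metric d_edge.
  exact: run_satisfies d_metric d_min d_max _ _ qs_gt0 iqs.
(* The harmonic bound turns [8 + 64 * h] into at most [72 + 64 * ln k], and [k >= 2] gives
   [1 <= ln k / ln 2]. *)
exists (14 * (72 / ln 2 + 64)) => V d qs [d_metric d_edge qs_gt0] /= k2.
have [d_min [J d_max]] := bounded V d d_metric d_edge.
have [[H Hqs <-] _] := OPT_min qs d_metric d_edge.
apply: le_trans (run_cost_le d_metric d_min d_max qs_gt0 Hqs) _.
apply: ler_wpM2r; first by apply: sumr_ge0 => e _; apply: metric_ge0.
rewrite -mulrA ler_wpM2l //.
have k0 : (0 < size (terminals qs))%N by apply: ltnW.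
have ln2 : 0 < ln 2 :> R by rewrite ln_gt0 // ltr1n.
have ln2k : ln 2 <= ln (size (terminals qs))%:R :> R.
  by rewrite ler_ln ?posrE ?ltr0n // ler_nat.
have : 1 <= (ln 2)^-1 * ln (size (terminals qs))%:R :> R by rewrite mulrC ler_pdivlMr // mul1r.
have := harmonic_sum_ln R k0.
move: (harmonic_sum _ _) (ln _%:R) (ln 2)^-1 => h lk l2 *; lra.
Qed.
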